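(* Let $q$ be a prime power, $E=\mathbb{F}_q^n$, let $\mathcal{M}_1=(\mathcal{L}(E),\rho_1)$, $\mathcal{M}_2=(\mathcal{L}(E),\rho_2)$ be two distinct $q$-matroids, let $\lambda\in\mathbb{Q}$ with $0<\lambda<1$, and let $\mathcal{M}=\lambda\mathcal{M}_1+(1-\lambda)\mathcal{M}_2$. Let $\mu=\mathrm{denom}(\lambda)$ and assume that there exists a one-dimensional subspace $x\le E$ which is strong independent in $\mathcal{M}$. Then $\mu$ is the principal denominator of $\mathcal{M}$.
   Context: A $q$-matroid is $(\mathcal{L}(E),\rho)$ with $\rho$ integer-valued, $0\le\rho(A)\le\dim A$, monotone and submodular. $\lambda\mathcal{M}_1+(1-\lambda)\mathcal{M}_2$ has rank function $\rho=\lambda\rho_1+(1-\lambda)\rho_2$. $\mathrm{denom}(\lambda)$ is $b$ where $\lambda=a/b$ in lowest terms. A denominator of $\mathcal{M}$ is $\nu\in\mathbb{Q}_{>0}$ with $\nu\rho(X)\in\mathbb{Z}_{\ge0}$ for all $X$; the principal denominator is the smallest one. For a denominator $\nu$, a space $I$ is $\nu$-independent if $\rho(J)\ge\dim(J)/\nu$ for all $J\le I$, and strong independent if it is $\nu$-independent and $\rho(I)=\dim I$. *)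

(* Defs.v *)
From mathcomp Require Import all_boot all_order all_algebra all_field.
From mathcomp Require Import ring lra.

Set Implicit Arguments.
Unset Strict Implicit.
Unset Printing Implicit Defensive.

Import Order.TTheory GRing.Theory Num.Theory.

Local Open Scope ring_scope.

(* The lattice L(E) of subspaces of E = F_q^n is {vspace 'rV[F]_n}, with F a
   finite field.  A convex combination of q-matroids is in general only
   rational-valued, hence a q-polymatroid. *)
Record qPolymatroid (F : finFieldType) (n : nat) := QPolymatroid {
  qrank :> {vspace 'rV[F]_n} -> rat;
  qrank_bounds : forall A, 0 <= qrank A <= (\dim A)%:R;
  qrank_mono : forall A B, (A <= B)%VS -> qrank A <= qrank B;
  qrank_submod : forall A B,
    qrank (A + B)%VS + qrank (A :&: B)%VS <= qrank A + qrank B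
}.

Record qMatroid (F : finFieldType) (n : nat) := QMatroid {
  qpolymatroid_of :> qPolymatroid F n;
  qrank_int : forall A, qpolymatroid_of A \is a Num.int
}.

Section ConvexCombination.
Variables (F : finFieldType) (n : nat) (lam : rat).
Hypothesis hlam : 0 < lam < 1.
Variables M1 M2 : qPolymatroid F n.

Definition convex_rank (A : {vspace 'rV[F]_n}) : rat :=
  lam * M1 A + (1 - lam) * M2 A.

Fact convex_rank_bounds A : 0 <= convex_rank A <= (\dim A)%:R.
Proof.
have /andP[l0 l1] := hlam; rewrite /convex_rank.
by have := qrank_bounds M1 A; have := qrank_bounds M2 A; nra.
Qed.

Fact convex_rank_mono A B : (A <= B)%VS -> convex_rank A <= convex_rank B.
Proof.
have /andP[l0 l1] := hlam; rewrite /convex_rank => sAB.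
by have := qrank_mono M1 sAB; have := qrank_mono M2 sAB; nra.
Qed.

Fact convex_rank_submod A B :
  convex_rank (A + B)%VS + convex_rank (A :&: B)%VS
    <= convex_rank A + convex_rank B.
Proof.
have /andP[l0 l1] := hlam; rewrite /convex_rank.
by have := qrank_submod M1 A B; have := qrank_submod M2 A B; nra.
Qed.

Definition convex_comb : qPolymatroid F n :=
  QPolymatroid convex_rank_bounds convex_rank_mono convex_rank_submod.

End ConvexCombination.

Section Denominators.
Variables (F : finFieldType) (n : nat) (M : qPolymatroid F n).

Definition is_denominator (nu : rat) : Prop :=
  0 < nu /\ forall X : {vspace 'rV[F]_n}, nu * M X \is a Num.nat.

Definition is_principal_denominator (nu : rat) : Prop :=
  is_denominator nu /\ forall nu' : rat, is_denominator nu' -> nu <= nu'.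

Definition independent (nu : rat) (I : {vspace 'rV[F]_n}) : Prop :=
  forall J : {vspace 'rV[F]_n}, (J <= I)%VS -> (\dim J)%:R / nu <= M J.

Definition strong_independent (nu : rat) (I : {vspace 'rV[F]_n}) : Prop :=
  independent nu I /\ M I = (\dim I)%:R.

End Denominators.

(* Main.v *)
Require Import Defs.
From mathcomp Require Import all_boot all_order all_algebra all_field.
From mathcomp Require Import zify ring lra.

Import Order.TTheory GRing.Theory Num.Theory.
Local Open Scope ring_scope.

(** A strong independent line has rank [1], so every denominator is an integer.
    Two distinct q-matroids have ranks differing by exactly [1] on some space:
    ranks agree at [0] and grow by [0] or [1] along a flag. On such a space a
    denominator [nu] satisfies [nu * lam \is a Num.int], and since [nu] is an
    integer it is a multiple of [denq lam]. *)

Lemma qrank_vspace0 (F : finFieldType) (n : nat) (M : qPolymatroid F n) :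
  M 0%VS = 0.
Proof.
by apply/eqP; rewrite eq_le andbC; have := qrank_bounds M 0; rewrite dimv0.
Qed.

(** Submodularity against [<[v]>], whose rank is at most [1], bounds the growth by [1]; integrality
    excludes values in between. *)
Lemma qrank_add_line (F : finFieldType) (n : nat) (M : qMatroid F n)
    (v : 'rV[F]_n) (Y : {vspace 'rV[F]_n}) :
  M (<[v]> + Y)%VS = M Y \/ M (<[v]> + Y)%VS = M Y + 1.
Proof.
have hmono : M Y <= M (<[v]> + Y)%VS := qrank_mono M (addvSr _ _).
have hstep : M (<[v]> + Y)%VS <= M Y + 1.
  have := qrank_submod M <[v]>%VS Y.
  have /andP[hcap _] := qrank_bounds M (<[v]> :&: Y)%VS.
  have /andP[_ hline] := qrank_bounds M <[v]>%VS.
  have : (\dim <[v]>)%:R <= 1 :> rat by rewrite (ler_nat _ _ 1) dim_vline leq_b1.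
  lra.
have /intrP[a ha] := qrank_int M Y.
have /intrP[b hb] := qrank_int M (<[v]> + Y)%VS.
move: hmono hstep; rewrite ha hb -(intrD _ a 1) !ler_int => hab hba.
have [->|->] : b = a \/ b = a + 1 by lia.
  by left.
by right; rewrite intrD.
Qed.

Lemma qMatroid_eq_diff1 (F : finFieldType) (n : nat) (M1 M2 : qMatroid F n) :
  (forall X, `|M1 X - M2 X| != 1) -> M1 =1 M2.
Proof.
move=> hdiff X; rewrite -(span_basis (vbasisP X)).
elim: (tval _) => [|v s hs]; first by rewrite span_nil !qrank_vspace0.
rewrite span_cons; have := hdiff (<[v]> + <<s>>)%VS.
have [->|->] := qrank_add_line _ _ M1 v <<s>>%VS;
  have [->|->] := qrank_add_line _ _ M2 v <<s>>%VS; rewrite hs //.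
(* Only one rank grows: the difference is [-1], then [1], against [hdiff]. *)
- by rewrite opprD addNKr normrN1 eqxx.
- by rewrite addrC addKr normr1 eqxx.
Qed.

(** Clearing the denominator gives [m * numq x = k * denq x], and [denq x] is coprime to
    [numq x]. *)
Lemma denq_dvd_int_mul (m : int) (x : rat) :
  m%:~R * x \is a Num.int -> (denq x %| m)%Z.
Proof.
move=> /intrP[k hk].
rewrite -(@Gauss_dvdzl _ _ (numq x)); last first.
  by rewrite coprimezE coprime_sym coprime_num_den.
apply/dvdzP; exists k; apply: (@intr_inj rat).
by rewrite !intrM -hk numqE mulrA.
Qed.

Lemma denq_is_denominator (F : finFieldType) (n : nat) (M1 M2 : qMatroid F n)
    (lam : rat) (hlam : 0 < lam < 1) :
  is_denominator (convex_comb hlam M1 M2) (denq lam)%:~R.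
Proof.
split=> [|X]; first by rewrite ltr0z denq_gt0.
have /andP[hX _] := qrank_bounds (convex_comb hlam M1 M2) X.
rewrite natrEint mulr_ge0 ?ler0z ?denq_ge0 // andbT /= /convex_rank.
(* This grouping isolates [lam * denq lam], which is the integer [numq lam]. *)
have -> : (denq lam)%:~R * (lam * M1 X + (1 - lam) * M2 X)
    = (lam * (denq lam)%:~R) * (M1 X - M2 X) + (denq lam)%:~R * M2 X by ring.
by rewrite -numqE rpredD ?rpredM ?rpredB ?intr_int ?qrank_int.
Qed.

Theorem theorem4p12 (F : finFieldType) (n : nat) (M1 M2 : qMatroid F n)
    (hM : ~ (M1 =1 M2)) (lam : rat) (hlam : 0 < lam < 1)
    (hx : exists (nu : rat) (x : {vspace 'rV[F]_n}),
      [/\ is_denominator (convex_comb hlam M1 M2) nu,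
          \dim x = 1%N
        & strong_independent (convex_comb hlam M1 M2) nu x]) :
  is_principal_denominator (convex_comb hlam M1 M2) (denq lam)%:~R.
Proof.
split=> [|nu [nu_gt0 hnu]]; first exact: denq_is_denominator.
have [_ [x [_ dimx [_ rkx]]]] := hx.
have := hnu x; rewrite rkx dimx mulr1 => /natrP[m def_nu].
apply: contraT => hlt; case: hM; apply: qMatroid_eq_diff1 => X.
(* It remains to derive [denq lam <= nu] from a space [X] where the ranks differ by [1]. *)
apply: contraNneq hlt => hX.
have lam_int : nu * lam \is a Num.int.
  have : nu * lam * (M1 X - M2 X) \is a Num.int.
    have -> : nu * lam * (M1 X - M2 X)
        = nu * convex_comb hlam M1 M2 X - nu * M2 X.
      by rewrite /= /convex_rank; ring.
    (* The second term is integral because [nu] is the natural number [m]. *)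
    apply: rpredB; first exact: intr_nat (hnu X).
    by rewrite rpredM ?qrank_int // def_nu natr_int.
  have [->|->] : M1 X - M2 X = 1 \/ M1 X - M2 X = -1.
    by case: (ler0P (M1 X - M2 X)) hX => _ h; [right|left]; lra.
  - by rewrite mulr1.
  - by rewrite mulrN1 rpredN.
have : (denq lam %| m%:Z)%Z.
  by apply: denq_dvd_int_mul; rewrite -pmulrn -def_nu.
rewrite dvdzE absz_nat => /dvdn_leq hle.
rewrite def_nu pmulrn ler_int -absz_denq lez_nat hle //.
(* Divisibility gives the bound only for [0 < m], which is [nu_gt0]. *)
by rewrite -(ltr_nat rat) -def_nu.
Qed.
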